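(* Let $k>0$, $I>0$, $0<A_1\le A_2\le A_3$, $J=\mathrm{diag}(A_1,A_2,A_3)$, and let $(\Omega,\Omega_1):[0,\infty)\to\mathbb{R}^3\times\mathbb{R}^3$ be a solution of $$\dot\Omega=J^{-1}\big(k(\Omega_1-\Omega)-\Omega\times(J\Omega)\big),\qquad \dot\Omega_1=-\frac{k}{I}(\Omega_1-\Omega)-\Omega\times\Omega_1 .$$ Write $\Omega(t)=(p(t),q(t),r(t))^T$. Then: (a) Suppose $A_1=A_2<A_3$. If $$(A_3-I)(A_3-A_1)r^2(0)+2\langle J\Omega(0),I\Omega_1(0)\rangle>A_1I\big(\|\Omega(0)\|^2+\|\Omega_1(0)\|^2\big),$$ then $\lim_{t\to\infty}p(t)=\lim_{t\to\infty}q(t)=0$. (b) Suppose $A_1<A_2<A_3$. If the following two conditions are satisfied: $$(A_2-I)(A_2-A_1)q^2(0)+(A_3-I)(A_3-A_1)r^2(0)+2\langle J\Omega(0),I\Omega_1(0)\rangle>A_1I\big(\|\Omega(0)\|^2+\|\Omega_1(0)\|^2\big),$$ $$(A_1-I)(A_1-A_2)p^2(0)+(A_3-I)(A_3-A_2)r^2(0)+2\langle J\Omega(0),I\Omega_1(0)\rangle>A_2I\big(\|\Omega(0)\|^2+\|\Omega_1(0)\|^2\big),$$ then $\lim_{t\to\infty}p(t)=\lim_{t\to\infty}q(t)=0$. (c) Suppose $A_1<A_2=A_3$. If $$(A_3-I)(A_3-A_1)\big(q^2(0)+r^2(0)\big)+2\langle J\Omega(0),I\Omega_1(0)\rangle>A_1I\big(\|\Omega(0)\|^2+\|\Omega_1(0)\|^2\big),$$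 then $\lim_{t\to\infty}p(t)=0$.
   Context: Here $\times$, $\langle\cdot,\cdot\rangle$ and $\|\cdot\|$ are the cross product, dot product and Euclidean norm in $\mathbb{R}^3$. $I$ is a positive scalar (not the identity matrix), so $I\Omega_1$ is a scalar multiple of $\Omega_1$. The components $p,q,r$ are taken in the orthonormal basis of eigenvectors of $J$ corresponding to $A_1,A_2,A_3$ respectively (the standard basis, as $J$ is diagonal). Every solution of the system exists for all $t\ge0$. *)

(* Defs.v *)
From HB Require Import structures.
From mathcomp Require Import all_boot all_order all_algebra.
From mathcomp Require Import all_classical all_reals all_analysis.

Set Implicit Arguments.
Unset Strict Implicit.
Unset Printing Implicit Defensive.

Import Order.TTheory GRing.Theory Num.Theory.
Import numFieldNormedType.Exports.

Local Open Scope classical_set_scope.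
Local Open Scope ring_scope.

Definition dotmul (R : realType) (u v : 'cV[R]_3) : R := (u^T *m v) 0 0.

(* The library norm `|u| on 'cV[R]_3 is the sup norm, hence a separate
   Euclidean norm. *)
Definition norm2 (R : realType) (u : 'cV[R]_3) : R := Num.sqrt (dotmul u u).

(* Indices in 'I_3 are added modulo 3, so this is the usual right-handed cross
   product (u1 v2 - u2 v1, u2 v0 - u0 v2, u0 v1 - u1 v0). *)
Definition crossmul (R : realType) (u v : 'cV[R]_3) : 'cV[R]_3 :=
  \col_(i < 3) (u (i + 1) 0 * v (i + 2) 0 - u (i + 2) 0 * v (i + 1) 0).

Definition diag3 (R : realType) (a b c : R) : 'M[R]_3 :=
  diag_mx (\row_(i < 3) [:: a; b; c]`_i).

(* Derivative relative to [0, +oo[: two-sided for t > 0 and one-sided at t = 0.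
   Values of f at negative times play no role. *)
Definition is_derive_nonneg (R : realType) (f : R -> 'cV[R]_3) (t : R)
    (df : 'cV[R]_3) : Prop :=
  (s - t)^-1 *: (f s - f t) @[s --> within [set s | 0 <= s] t^'] --> df.

Definition is_solution (R : realType) (k I : R) (J : 'M[R]_3)
    (Om Om1 : R -> 'cV[R]_3) : Prop :=
  forall t : R, 0 <= t ->
    is_derive_nonneg Om t
      (invmx J *m (k *: (Om1 t - Om t) - crossmul (Om t) (J *m Om t)))
    /\ is_derive_nonneg Om1 t
      (- (k / I) *: (Om1 t - Om t) - crossmul (Om t) (Om1 t)).

(* Main.v *)
Require Import Defs.
From HB Require Import structures.
From mathcomp Require Import all_boot all_order all_algebra.
From mathcomp Require Import all_classical all_reals all_analysis.
From mathcomp Require Import ring lra.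

Set Implicit Arguments.
Unset Strict Implicit.
Unset Printing Implicit Defensive.

Import Order.TTheory GRing.Theory Num.Theory.
Import numFieldNormedType.Exports.

Local Open Scope classical_set_scope.
Local Open Scope ring_scope.

(** Write D = Om1 - Om for the slip between the two bodies, and let
    E = <J Om, Om> + I |Om1|^2 (twice the kinetic energy) and
    G = J Om + I Om1 (the angular momentum in the rotating frame).  The
    equations say J Om' = k D - Om x J Om and I Om1' = - k D - Om x (I Om1), so
    G' = - Om x G, hence |G|^2 is conserved, while E' = - 2 k |D|^2: the energy
    is dissipated exactly by the slip.  In particular all the components stay
    bounded, and so do their derivatives.

    For a real b put K_b = |G|^2 - (b + I) E.  For b >= 0 it is nondecreasing
    in time.  Expanding K_b at time 0 shows that the inequality assumed in (a)
    and (c) is K_(A1)(0) > 0, and the second one in (b) is K_(A2)(0) > 0.  All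
    three parts then follow from a single statement ([component_decay]):

      if K_b(0) > 0 and A_i <= b, then the i-th component of Om tends to 0.

    Its proof has two ingredients.

    First, E is monotone and bounded below, so it converges, and Barbalat's
    lemma ([barbalat]) gives E' -> 0, that is D -> 0.  The same lemma applied
    to each component of D gives D' -> 0.  As Om x Om1 = Om x D -> 0, what
    remains in D' is the gyroscopic torque, so Om x J Om -> 0: the products
    (A_j - A_i) Om_i Om_j tend to 0 ([w_mul_cvg0]).

    Second, replacing Om1 by Om + D in K_b shows that
    K_b = sum_j (A_j - b) (A_j + I) Om_j^2 + o(1) ([excess_asymptotics]).
    Since K_b stays above its positive initial value, the part of this sum over
    the indices with A_j > b is eventually bounded away from 0.  Multiplied by
    Om_i^2 with A_i <= b this part tends to 0, because A_i < A_j makes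
    Om_i Om_j tend to 0; hence Om_i tends to 0. *)

(** * Differentiable functions on the half-line *)

Section HalfLine.
Variable R : realType.
Implicit Types (f g b : R -> R) (c e l : R).

(** Right continuity at 0, instead of a one-sided derivative there, is all that
    the mean value theorem on [0, t] asks for, and it is stable under the
    algebraic operations below. *)
Definition deriv_nonneg f g : Prop :=
  f s @[s --> 0^'+] --> f 0 /\ forall t : R, 0 < t -> is_derive t 1 f (g t).

Lemma deriv_nonneg_cst c : deriv_nonneg (fun=> c) (fun=> 0).
Proof. by split=> [|t _]; [exact: cvg_cst | exact: is_derive_cst]. Qed.

Lemma deriv_nonnegD f1 g1 f2 g2 :
  deriv_nonneg f1 g1 -> deriv_nonneg f2 g2 ->
  deriv_nonneg (fun t => f1 t + f2 t) (fun t => g1 t + g2 t).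
Proof.
move=> [c1 d1] [c2 d2]; split=> [|t t0]; first exact: cvgD.
by have := d1 _ t0; have := d2 _ t0 => ? ?; exact: is_deriveD.
Qed.

Lemma deriv_nonnegM f1 g1 f2 g2 :
  deriv_nonneg f1 g1 -> deriv_nonneg f2 g2 ->
  deriv_nonneg (fun t => f1 t * f2 t) (fun t => f1 t * g2 t + f2 t * g1 t).
Proof.
move=> [c1 d1] [c2 d2]; split=> [|t t0]; first exact: cvgM.
by have := d1 _ t0; have := d2 _ t0 => ? ?; exact: is_deriveM.
Qed.

Lemma deriv_nonneg_sum (n : nat) (f g : 'I_n -> R -> R) :
  (forall i, deriv_nonneg (f i) (g i)) ->
  deriv_nonneg (fun t => \sum_i f i t) (fun t => \sum_i g i t).
Proof.
move=> fg.
have : deriv_nonneg (\sum_i f i) (\sum_i g i).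
  apply: (big_ind2 deriv_nonneg) => [|f1 g1 f2 g2|i _]; last exact: fg.
    exact: deriv_nonneg_cst.
  exact: deriv_nonnegD.
by congr deriv_nonneg; apply/funext => t; rewrite fct_sumE.
Qed.

Lemma deriv_nonneg_eq f g h :
  deriv_nonneg f g -> (forall t, 0 < t -> g t = h t) -> deriv_nonneg f h.
Proof. by move=> [fc fg] gh; split=> // t t0; rewrite -gh//; exact: fg. Qed.

Lemma deriv_nonneg_MVT f g s t : deriv_nonneg f g -> 0 <= s -> s < t ->
  exists2 c, s < c < t & f t - f s = g c * (t - s).
Proof.
move=> [f0 fg] s0 st.
have fc x : 0 < x -> {for x, continuous f}.
  move=> /fg fx; apply/differentiable_continuous/derivable1_diffP.
  exact: ex_derive.
have [||c + ->] := @MVT R f g s t st.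
- by move=> x /[!in_itv]/= /andP[sx _]; apply: fg; exact: le_lt_trans sx.
- apply/continuous_within_itvP => //; split.
  + by move=> x /[!in_itv]/= /andP[sx _]; apply: fc; exact: le_lt_trans sx.
  + move: s0; rewrite le_eqVlt => /predU1P[<-//|s0].
    by apply: cvg_at_right_filter; exact: fc.
  + by apply: cvg_at_left_filter; apply: fc; exact: le_lt_trans st.
- by rewrite in_itv/=; exists c.
Qed.

Lemma deriv_nonneg_nondecr f g : deriv_nonneg f g ->
  (forall t, 0 < t -> 0 <= g t) ->
  forall s t, 0 <= s -> s <= t -> f s <= f t.
Proof.
move=> fg g0 s t s0; rewrite le_eqVlt => /predU1P[->//|st].
have [c /andP[sc _] fst] := deriv_nonneg_MVT fg s0 st.
rewrite -subr_ge0 fst mulr_ge0 ?subr_ge0 ?(ltW st)// g0//.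
exact: le_lt_trans sc.
Qed.

Definition bounded_nonneg f : Prop :=
  exists M : R, forall t : R, 0 < t -> `|f t| <= M.

Lemma bounded_nonneg_cst c : bounded_nonneg (fun=> c).
Proof. by exists `|c|. Qed.

Lemma bounded_nonnegD f g : bounded_nonneg f -> bounded_nonneg g ->
  bounded_nonneg (fun t => f t + g t).
Proof.
move=> [M fM] [N gN]; exists (M + N) => t t0.
by apply: le_trans (ler_normD _ _) _; apply: lerD; auto.
Qed.

Lemma bounded_nonnegM f g : bounded_nonneg f -> bounded_nonneg g ->
  bounded_nonneg (fun t => f t * g t).
Proof.
move=> [M fM] [N gN]; exists (M * N) => t t0.
by rewrite normrM ler_pM //; auto.
Qed.

(** The components of a bounded solution of a polynomial system are tame, and
    so is every polynomial in them: this is how the second derivatives occurring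
    in Barbalat's lemma are bounded without computing them. *)
Definition tame f : Prop :=
  bounded_nonneg f /\ exists2 g, deriv_nonneg f g & bounded_nonneg g.

Lemma tame_cst c : tame (fun=> c).
Proof.
split; first exact: bounded_nonneg_cst.
by exists (fun=> 0); [exact: deriv_nonneg_cst | exact: bounded_nonneg_cst].
Qed.

Lemma tameD f g : tame f -> tame g -> tame (fun t => f t + g t).
Proof.
move=> [fb [f' ff' f'b]] [gb [g' gg' g'b]]; split; first exact: bounded_nonnegD.
exists (fun t => f' t + g' t); first exact: deriv_nonnegD.
exact: bounded_nonnegD.
Qed.

Lemma tameM f g : tame f -> tame g -> tame (fun t => f t * g t).
Proof.
move=> [fb [f' ff' f'b]] [gb [g' gg' g'b]]; split; first exact: bounded_nonnegM.
exists (fun t => f t * g' t + g t * f' t); first exact: deriv_nonnegM.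
by apply: bounded_nonnegD; exact: bounded_nonnegM.
Qed.

Lemma tameB f g : tame f -> tame g -> tame (fun t => f t - g t).
Proof.
move=> tf tg; have := tameD tf (tameM (tame_cst (-1)) tg).
by congr tame; apply/funext => t; rewrite mulN1r.
Qed.

Lemma bounded_nonnegB f g : bounded_nonneg f -> bounded_nonneg g ->
  bounded_nonneg (fun t => f t - g t).
Proof.
move=> [M fM] [N gN]; exists (M + N) => t t0.
by apply: le_trans (ler_normB _ _) _; apply: lerD; auto.
Qed.

Lemma cvg0_sum (n : nat) (f : 'I_n -> R -> R) :
  (forall i, f i t @[t --> +oo] --> (0 : R)) ->
  \sum_i f i t @[t --> +oo] --> (0 : R).
Proof.
move=> f0; have -> : (fun t => \sum_i f i t) = \sum_i f i.
  by apply/funext => t; rewrite fct_sumE.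
apply: (big_ind (fun h : R -> R => h t @[t --> +oo] --> (0 : R)))
  => [|h1 h2 ? ?|//].
  exact: cvg_cst.
by rewrite -[X in _ --> X](addr0 0); exact: cvgD.
Qed.

Lemma nonincr_cvg f : (forall s t, 0 <= s -> s <= t -> f t <= f s) ->
  (forall t, 0 <= t -> 0 <= f t) -> exists l, f t @[t --> +oo] --> l.
Proof.
move=> fdecr f0; pose F t := - f (Num.max 0 t).
have Fincr : nondecreasing_fun F.
  move=> s t st; rewrite lerN2; apply: fdecr; first by rewrite le_max lexx.
  by rewrite ge_max !le_max lexx st orbT.
have Fub : has_ubound (range F).
  by exists 0 => _ [t _ <-]; rewrite oppr_le0 f0// le_max lexx.
exists (- sup (range F)).
apply: cvg_trans (cvgN (nondecreasing_cvgr Fincr Fub)).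
apply: near_eq_cvg; near=> t.
rewrite /F /= opprK max_r//; near: t; exact: nbhs_pinfty_ge.
Unshelve. all: by end_near. Qed.

(** Barbalat's lemma, for a derivative g that is Lipschitz.  Over a step d, the
    mean of g is (f (t + d) - f t) / d, which is small for large t, while g
    varies by at most M d; taking d proportional to e makes both at most
    e / 2. *)
Lemma barbalat f g h l : deriv_nonneg f g -> deriv_nonneg g h ->
  bounded_nonneg h -> f t @[t --> +oo] --> l -> g t @[t --> +oo] --> 0.
Proof.
move=> fg gh [M hM] fl; apply/cvgr0Pnorm_le => e e0.
have M0 : 0 <= M by apply: le_trans (hM 1 ltr01).
(* M + 1 rather than M, as M may be 0 *)
pose d := e / (2 * (M + 1)).
have d0 : 0 < d by rewrite divr_gt0// mulr_gt0// ltr_wpDl.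
have ed : 0 < e * d / 4 by rewrite divr_gt0// mulr_gt0.
have [T [_ fT]] : \forall t \near +oo, `|l - f t| <= e * d / 4.
  by move/cvgrPdist_le: fl; exact.
near=> t.
have Tt : T < t by near: t; exact/nbhs_pinfty_gt/num_real.
have t0 : 0 < t by near: t; exact/nbhs_pinfty_gt/num_real.
have tD : t < t + d by rewrite ltrDl.
have [c /andP[tc cd] fc] := deriv_nonneg_MVT fg (ltW t0) tD.
have [u /andP[tu uc] gu] := deriv_nonneg_MVT gh (ltW t0) tc.
have hu := hM u (lt_trans t0 tu).
have f1 := fT t Tt; have f2 := fT _ (lt_trans Tt tD).
have gc : `|g c| <= e / 2.
  rewrite -(ler_pM2r d0) -[X in _ * X <= _](gtr0_norm d0) -normrM.
  have -> : g c * d = (l - f t) - (l - f (t + d)).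
    by move: fc; rewrite [t + d - t]addrC addKr => <-; ring.
  apply: le_trans (ler_normB _ _) _; lra.
have gtc : `|g c - g t| <= e / 2.
  rewrite gu normrM (le_trans (ler_pM _ _ hu (_ : _ <= d)))//.
    by rewrite ger0_norm ?subr_ge0 ?(ltW tc)//; lra.
  have -> : e / 2 = (M + 1) * d by rewrite /d; field; lra.
  by rewrite ler_pM2r//; lra.
have -> : g t = g c - (g c - g t) by ring.
apply: le_trans (ler_normB _ _) _; lra.
Unshelve. all: by end_near. Qed.

Lemma bounded_cvg0M b f : bounded_nonneg b -> f t @[t --> +oo] --> (0 : R) ->
  b t * f t @[t --> +oo] --> (0 : R).
Proof.
move=> [M bM] f0; have M0 : 0 <= M by apply: le_trans (bM 1 ltr01).
apply/norm_cvg0P; apply: (@squeeze_cvgr _ _ _ _ (cst 0) (fun t => M * `|f t|)).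
- near=> t.
  have t0 : 0 < t by near: t; exact/nbhs_pinfty_gt/num_real.
  by rewrite /= normr_ge0 normrM ler_wpM2r// bM.
- exact: cvg_cst.
- rewrite -[X in _ --> X](mulr0 M); apply: cvgM; first exact: cvg_cst.
  exact/norm_cvg0P.
Unshelve. all: by end_near. Qed.

Lemma cvg0_sqr f : f t ^+ 2 @[t --> +oo] --> (0 : R) ->
  f t @[t --> +oo] --> (0 : R).
Proof.
move=> f0; apply/cvgr0Pnorm_le => e e0.
have e20 : 0 < e ^+ 2 by rewrite exprn_gt0.
move/cvgr0Pnorm_le: f0 => /(_ _ e20); apply: filterS => t.
by rewrite normrX ler_pXn2r// nnegrE ltW.
Qed.

(** A factor w that stays away from 0 can be cancelled from a limit 0. *)
Lemma cvg0_weight f w e : 0 < e -> (\forall t \near +oo, e <= w t) ->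
  f t ^+ 2 * w t @[t --> +oo] --> (0 : R) -> f t @[t --> +oo] --> (0 : R).
Proof.
move=> e0 ew fw; apply: cvg0_sqr.
apply: (@squeeze_cvgr _ _ _ _ (cst 0) (fun t => e^-1 * (f t ^+ 2 * w t))).
- near=> t; rewrite /= sqr_ge0/= ler_pdivlMl// mulrC ler_wpM2l ?sqr_ge0//.
  by near: t.
- exact: cvg_cst.
- by rewrite -[X in _ --> X](mulr0 e^-1); apply: cvgM => //; exact: cvg_cst.
Unshelve. all: by end_near. Qed.


(** The bridge from derivatives relative to [0, +oo[: at 0 the slope only
    yields right continuity, and at t > 0 the constraint 0 <= s holds near t. *)
Lemma slope_deriv_nonneg f g :
  (forall t : R, 0 <= t ->
    (s - t)^-1 * (f s - f t) @[s --> within [set s | 0 <= s] t^'] --> g t) ->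
  deriv_nonneg f g.
Proof.
move=> fg; split=> [|t t0].
  have sub : 0^'+ `=>` within [set s : R | 0 <= s] 0^'.
    move=> P nP.
    have {nP} : \forall x \near (0 : R), x != 0 -> 0 <= x -> P x := nP.
    have -> : 0^'+ P = (\forall x \near (0 : R), 0 < x -> P x) by [].
    by apply: filterS => x xP x0; apply: xP; [rewrite gt_eqF | exact: ltW].
  have slope : (s - 0)^-1 * (f s - f 0) @[s --> 0^'+] --> g 0.
    by apply: (cvg_trans _ (fg 0 (lexx 0))); exact: cvg_app.
  have id0 : (s : R) @[s --> 0^'+] --> (0 : R).
    by apply: cvg_at_right_filter; exact: cvg_id.
  have lim : f 0 + s * ((s - 0)^-1 * (f s - f 0)) @[s --> 0^'+] --> f 0.
    rewrite [X in _ --> X](_ : _ = f 0 + 0 * g 0); last by rewrite mul0r addr0.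
    by apply: cvgD; [exact: cvg_cst | exact: cvgM].
  apply: (cvg_trans _ lim); apply: near_eq_cvg.
  near=> s.
  have s0 : 0 < s by near: s; exact: nbhs_right_gt.
  by rewrite /= subr0 mulVKf ?gt_eqF// addrC subrK.
have dg : (fun h => h^-1 *: ((f \o shift t) (h *: 1) - f t)) @ 0^' --> g t.
  have shift_t : h + t @[h --> 0^'] --> within [set s : R | 0 <= s] t^'.
    move=> P nP.
    have {nP} /nbhs0P : \forall x \near t, x != t -> 0 <= x -> P x := nP.
    move=> nP; have near0 : \forall h \near (0 : R), 0 <= h + t.
      have /lt_nbhsr : - t < 0 by rewrite oppr_lt0.
      by apply: filterS => h; rewrite -subr_gt0 opprK => /ltW.
    suff : \forall h \near (0 : R), h != 0 -> P (h + t) by [].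
    near=> h => h0.
    have tP : t + h != t -> 0 <= t + h -> P (t + h) by near: h.
    rewrite addrC; apply: tP; first by rewrite -subr_eq0 addrAC subrr add0r.
    by rewrite addrC; near: h.
  apply: (cvg_trans _ (cvg_comp _ _ shift_t (fg t (ltW t0)))).
  apply: near_eq_cvg; near=> h.
  by rewrite /= addrK /GRing.scale/= mulr1.
by apply: DeriveDef; [apply/cvg_ex; exists (g t) | exact: cvg_lim dg].
Unshelve. all: by end_near. Qed.

End HalfLine.

(** * Indices modulo 3 *)

Lemma sum3E (V : nmodType) (F : 'I_3 -> V) : \sum_i F i = F 0 + F 1 + F 2.
Proof.
rewrite !big_ord_recl big_ord0 addr0 addrA.
by congr (F _ + F _ + F _); exact: val_inj.
Qed.

Lemma ord3E :
  ((0 + 1)%R = 1%R :> 'I_3) * ((0 + 2)%R = 2%R :> 'I_3)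
  * ((1 + 1)%R = 2%R :> 'I_3) * ((1 + 2)%R = 0%R :> 'I_3)
  * ((2 + 1)%R = 0%R :> 'I_3) * ((2 + 2)%R = 1%R :> 'I_3).
Proof. by do !split; exact: val_inj. Qed.

Lemma ord3_cases (P : 'I_3 -> Prop) : P 0 -> P 1 -> P 2 -> forall i, P i.
Proof.
move=> P0 P1 P2 [[|[|[|//]]] i3].
- by rewrite (_ : Ordinal i3 = 0)//; exact: val_inj.
- by rewrite (_ : Ordinal i3 = 1)//; exact: val_inj.
- by rewrite (_ : Ordinal i3 = 2)//; exact: val_inj.
Qed.

(** * The coupled system in coordinates *)

(** Indices are taken modulo 3, so that one formula covers the three cyclic
    permutations of Euler's equations. *)
Section Dynamics.
Variables (R : realType) (k I : R) (a : 'I_3 -> R) (w w1 : 'I_3 -> R -> R).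
Hypotheses (k_gt0 : 0 < k) (I_gt0 : 0 < I) (a_gt0 : forall i, 0 < a i).

Let slip i t := w1 i t - w i t.
Let gyro i t := (a (i + 2) - a (i + 1)) * (w (i + 1) t * w (i + 2) t).
Let dw i t := (a i)^-1 * (k * slip i t - gyro i t).
Let dw1 i t :=
  - (k / I) * slip i t
  - (w (i + 1) t * w1 (i + 2) t - w (i + 2) t * w1 (i + 1) t).

Hypothesis w_deriv : forall i, deriv_nonneg (w i) (dw i).
Hypothesis w1_deriv : forall i, deriv_nonneg (w1 i) (dw1 i).

(** Twice the kinetic energy. *)
Definition energy t := \sum_i (a i * (w i t * w i t) + I * (w1 i t * w1 i t)).

Definition momentum i t := a i * w i t + I * w1 i t.

(** A rotation of both bodies about the i-th axis at the speed x has momentum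
    (a i + I) x and doubled energy (a i + I) x^2, so on it the excess has the
    sign of a i - b: a positive excess excludes the axes with a i <= b as limit
    axes. *)
Definition excess b t :=
  \sum_i momentum i t * momentum i t - (b + I) * energy t.

Let slip_sqr t := \sum_i slip i t * slip i t.

Lemma slip_sqr_ge0 t : 0 <= slip_sqr t.
Proof. by apply: sumr_ge0 => i _; rewrite -expr2 sqr_ge0. Qed.

Lemma energy_ge0 t : 0 <= energy t.
Proof.
apply: sumr_ge0 => i _; rewrite -!expr2.
by rewrite addr_ge0// mulr_ge0// ?sqr_ge0// ltW.
Qed.

(** The gyroscopic terms Om x J Om and Om x Om1 are orthogonal to Om and to Om1
    respectively, hence do no work: only the friction survives. *)
Lemma energy_deriv : deriv_nonneg energy (fun t => - (2 * k) * slip_sqr t).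
Proof.
apply: deriv_nonneg_eq.
  apply: deriv_nonneg_sum => i; apply: deriv_nonnegD.
    by apply: deriv_nonnegM; [exact: deriv_nonneg_cst | exact: deriv_nonnegM].
  by apply: deriv_nonnegM; [exact: deriv_nonneg_cst | exact: deriv_nonnegM].
move=> t _; rewrite /slip_sqr !sum3E /dw /dw1 /gyro /slip !ord3E.
by field; rewrite !gt_eqF.
Qed.

(** The internal friction cancels in the total momentum G, whose derivative
    - Om x G is orthogonal to G. *)
Lemma momentum_deriv :
  deriv_nonneg (fun t => \sum_i momentum i t * momentum i t) (fun=> 0).
Proof.
apply: deriv_nonneg_eq.
  apply: deriv_nonneg_sum => i; apply: deriv_nonnegM; apply: deriv_nonnegD.
  1-4: by apply: deriv_nonnegM; [exact: deriv_nonneg_cst | ].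
move=> t _ /=; rewrite !sum3E /momentum /dw /dw1 /gyro /slip !ord3E.
by field; rewrite !gt_eqF.
Qed.

Lemma excess_deriv b :
  deriv_nonneg (excess b) (fun t => 2 * k * (b + I) * slip_sqr t).
Proof.
have := deriv_nonnegD momentum_deriv
  (deriv_nonnegM (deriv_nonneg_cst (- (b + I))) energy_deriv).
rewrite (_ : (fun t => _ + _) = excess b).
  by move/deriv_nonneg_eq; apply => t _; ring.
by apply/funext => t; rewrite /excess mulNr.
Qed.

Lemma energy_nonincr s t : 0 <= s -> s <= t -> energy t <= energy s.
Proof.
have dE := deriv_nonnegM (deriv_nonneg_cst (-1)) energy_deriv.
move=> s0 st; rewrite -lerN2 -(mulN1r (energy s)) -(mulN1r (energy t)).
apply: (deriv_nonneg_nondecr dE) => // u _.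
rewrite mulr0 addr0 mulN1r mulNr opprK.
by rewrite mulr_ge0 ?slip_sqr_ge0// mulr_ge0// ltW.
Qed.

Lemma excess_nondecr b t : 0 <= b -> 0 <= t -> excess b 0 <= excess b t.
Proof.
move=> b0 t0; apply: (deriv_nonneg_nondecr (excess_deriv b)) => // u _.
have bI : 0 <= b + I by rewrite addr_ge0// ltW.
by rewrite mulr_ge0 ?slip_sqr_ge0// mulr_ge0// mulr_ge0// ltW.
Qed.

Lemma bounded_of_energy (c : R) f : 0 < c ->
  (forall t, 0 < t -> c * (f t * f t) <= energy t) -> bounded_nonneg f.
Proof.
move=> c0 fE; exists (1 + energy 0 / c) => t t0.
have f2E : f t * f t <= energy 0 / c.
  rewrite ler_pdivlMr// mulrC; apply: le_trans (fE _ t0) _.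
  by apply: energy_nonincr => //; exact: ltW.
(* |x| <= 1 + x^2, from the squares of x - 1 and x + 1 *)
have := sqr_ge0 (f t - 1); have := sqr_ge0 (f t + 1); have := sqr_ge0 (f t).
by rewrite ler_norml; move=> ? ? ?; apply/andP; split; nra.
Qed.

Lemma bounded_w i : bounded_nonneg (w i).
Proof.
apply: (bounded_of_energy (a_gt0 i)) => t _.
rewrite /energy (bigD1 i)//= -addrA lerDl addr_ge0//.
  by rewrite -expr2 mulr_ge0 ?sqr_ge0// ltW.
apply: sumr_ge0 => j _; rewrite -!expr2.
by rewrite addr_ge0// mulr_ge0// ?sqr_ge0// ltW.
Qed.

Lemma bounded_w1 i : bounded_nonneg (w1 i).
Proof.
apply: (bounded_of_energy I_gt0) => t _.
rewrite /energy (bigD1 i)//= addrAC lerDr addr_ge0//.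
  by rewrite -expr2 mulr_ge0 ?sqr_ge0// ltW.
apply: sumr_ge0 => j _; rewrite -!expr2.
by rewrite addr_ge0// mulr_ge0// ?sqr_ge0// ltW.
Qed.

Ltac bounded := repeat first [exact: bounded_nonneg_cst | exact: bounded_w
  | exact: bounded_w1 | apply: bounded_nonnegB | apply: bounded_nonnegM].

Lemma tame_w i : tame (w i).
Proof.
split; first exact: bounded_w.
by exists (dw i) => //; rewrite /dw /gyro /slip; bounded.
Qed.

Lemma tame_w1 i : tame (w1 i).
Proof.
split; first exact: bounded_w1.
by exists (dw1 i) => //; rewrite /dw1 /slip; bounded.
Qed.

Ltac tame := repeat first [exact: tame_cst | exact: tame_w
  | exact: tame_w1 | apply: tameB | apply: tameD | apply: tameM].

(** The energy converges, so by Barbalat's lemma its derivative, a multiple of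
    slip_sqr, tends to 0. *)
Lemma slip_cvg0 i : slip i t @[t --> +oo] --> (0 : R).
Proof.
have tame_slip : tame (fun t => - (2 * k) * slip_sqr t).
  rewrite /slip_sqr; under eq_fun do rewrite sum3E.
  by rewrite /slip; tame.
have [l El] := nonincr_cvg energy_nonincr (fun t _ => energy_ge0 t).
have [_ [h slip_h h_bnd]] := tame_slip.
have slip0 := barbalat energy_deriv slip_h h_bnd El.
apply: cvg0_sqr.
apply: (@squeeze_cvgr _ _ _ _ (cst 0)
  (fun t => (- (2 * k))^-1 * (- (2 * k) * slip_sqr t))).
- near=> t; rewrite /= sqr_ge0/= mulKf ?oppr_eq0 ?mulf_neq0 ?gt_eqF//.
  rewrite /slip_sqr (bigD1 i)//= expr2 lerDl.
  by apply: sumr_ge0 => j _; rewrite -expr2 sqr_ge0.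
- exact: cvg_cst.
- rewrite [X in _ --> X](_ : _ = (- (2 * k))^-1 * 0); last by rewrite mulr0.
  by apply: cvgM => //; exact: cvg_cst.
Unshelve. all: by end_near. Qed.

(** Barbalat's lemma for the slip, which tends to 0 and hence has a derivative
    tending to 0; every term of that derivative other than the gyroscopic one
    contains a factor slip. *)
Lemma gyro_cvg0 i : gyro i t @[t --> +oo] --> (0 : R).
Proof.
pose dD t := dw1 i t - dw i t.
have D_deriv : deriv_nonneg (slip i) dD.
  have := deriv_nonnegD (w1_deriv i)
    (deriv_nonnegM (deriv_nonneg_cst (-1)) (w_deriv i)).
  rewrite (_ : (fun t => _ + -1 * _) = slip i).
    by move/deriv_nonneg_eq; apply => t _; rewrite mulr0 addr0 mulN1r.
  by apply/funext => t; rewrite mulN1r.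
have tame_dD : tame dD.
  by rewrite /dD /dw1 /dw /gyro /slip; tame.
have [_ [h dD_h h_bnd]] := tame_dD.
have dD0 := barbalat D_deriv dD_h h_bnd (@slip_cvg0 i).
(* In Om x Om1 the part Om x Om vanishes, which leaves Om x slip. *)
have -> : gyro i = fun t => a i * (dD t + (k / I + k / a i) * slip i t
    + (w (i + 1) t * slip (i + 2) t - w (i + 2) t * slip (i + 1) t)).
  apply/funext => t; rewrite /dD /dw1 /dw /slip.
  by field; rewrite !gt_eqF.
rewrite [X in _ --> X](_ : _ = a i * (0 + (k / I + k / a i) * 0 + (0 - 0))).
  apply: cvgM; first exact: cvg_cst.
  apply: cvgD.
    apply: cvgD => //.
    by apply: cvgM; [exact: cvg_cst | exact: slip_cvg0].
  by apply: cvgB; apply: bounded_cvg0M; (exact: bounded_w || exact: slip_cvg0).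
by rewrite mulr0 subrr !addr0 mulr0.
Qed.

Lemma w_mul_cvg0 i j : a i != a j -> w i t * w j t @[t --> +oo] --> (0 : R).
Proof.
have consec m : a (m + 1) != a (m + 2) ->
    w (m + 1) t * w (m + 2) t @[t --> +oo] --> (0 : R).
  move=> am.
  have -> : (fun t => w (m + 1) t * w (m + 2) t)
      = fun t => (a (m + 2) - a (m + 1))^-1 * gyro m t.
    by apply/funext => t; rewrite /gyro mulKf// subr_eq0 eq_sym.
  apply: bounded_cvg0M; [exact: bounded_nonneg_cst | exact: gyro_cvg0].
move: (consec 0) (consec 1) (consec 2); rewrite !ord3E => c0 c1 c2.
elim/ord3_cases: i; elim/ord3_cases: j; rewrite ?eqxx// => aij.
all: try by [apply: c0|apply: c1|apply: c2].
all: under eq_fun do rewrite mulrC.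
all: rewrite eq_sym in aij.
all: by [apply: c0|apply: c1|apply: c2].
Qed.

(** Substituting w + slip for w1, the difference is a quadratic form each term
    of which contains a factor slip. *)
Lemma excess_asymptotics b :
  excess b t - \sum_i (a i - b) * (a i + I) * w i t ^+ 2 @[t --> +oo]
    --> (0 : R).
Proof.
have -> : (fun t => excess b t - \sum_i (a i - b) * (a i + I) * w i t ^+ 2)
    = fun t => \sum_i (2 * I * (a i - b) * w i t - b * I * slip i t) * slip i t.
  apply/funext => t; rewrite /excess /energy /momentum /slip !sum3E; ring.
apply: cvg0_sum => i; apply: bounded_cvg0M; last exact: slip_cvg0.
by rewrite /slip; bounded.
Qed.

(** The sum over the axes with a j > b of (a j - b) (a j + I) w_j^2 is
    eventually at least half of the initial excess, whereas its product with
    w_i^2 tends to 0. *)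
Lemma component_decay b i : 0 <= b -> a i <= b -> 0 < excess b 0 ->
  w i t @[t --> +oo] --> (0 : R).
Proof.
move=> b0 aib K0.
(* Dropping the axes with a j <= b only increases the sum. *)
pose c j := Num.max 0 (a j - b) * (a j + I).
apply: (@cvg0_weight _ _ (fun t => \sum_j c j * w j t ^+ 2) (excess b 0 / 2)).
- by rewrite divr_gt0.
- have K20 : 0 < excess b 0 / 2 by rewrite divr_gt0.
  move/cvgr0Pnorm_le: (@excess_asymptotics b) => /(_ _ K20) lim.
  near=> t.
  have t0 : 0 <= t by near: t; exact/nbhs_pinfty_ge/num_real.
  have : `|excess b t - \sum_i (a i - b) * (a i + I) * w i t ^+ 2|
    <= excess b 0 / 2 by near: t.
  have := excess_nondecr b0 t0.
  have : \sum_i (a i - b) * (a i + I) * w i t ^+ 2 <= \sum_j c j * w j t ^+ 2.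
    apply: ler_sum => j _; rewrite ler_wpM2r ?sqr_ge0// ler_wpM2r//.
      by rewrite addr_ge0// ltW.
    by rewrite le_max lexx orbT.
  rewrite ler_norml => ? ? /andP[_ ?]; lra.
- under eq_fun do rewrite mulr_sumr.
  apply: cvg0_sum => j.
  have [ajb|baj] := leP (a j) b.
    rewrite /c max_l ?subr_le0//; under eq_fun do rewrite !mul0r mulr0.
    exact: cvg_cst.
  under eq_fun do rewrite mulrCA -exprMn expr2.
  apply: bounded_cvg0M; first exact: bounded_nonneg_cst.
  apply: bounded_cvg0M; first by bounded.
  by apply: w_mul_cvg0; rewrite lt_eqF// (le_lt_trans aib).
Unshelve. all: by end_near. Qed.

End Dynamics.

(** * From vectors to coordinates *)

Lemma is_derive_nonneg_coord (R : realType) (f : R -> 'cV[R]_3) (t : R) df i :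
  is_derive_nonneg f t df ->
  (s - t)^-1 * (f s i 0 - f t i 0) @[s --> within [set s | 0 <= s] t^']
    --> df i 0.
Proof.
move=> fdf.
have lim := continuous_cvg _ (@coord_continuous R 3 1 i 0 df) fdf.
by apply: (cvg_trans _ (lim _)); apply: near_eq_cvg; near=> s; rewrite /= !mxE.
Unshelve. all: by end_near. Qed.

Lemma diag3_mulmxE (R : realType) (a b c : R) (v : 'cV[R]_3) i :
  (diag3 a b c *m v) i 0 = [:: a; b; c]`_i * v i 0.
Proof. by rewrite /diag3 mul_diag_mx !mxE. Qed.

Lemma invmx_diag3_mulmxE (R : realType) (a b c : R) (v : 'cV[R]_3) i :
  (forall j : 'I_3, [:: a; b; c]`_j != 0) ->
  (invmx (diag3 a b c) *m v) i 0 = ([:: a; b; c]`_i)^-1 * v i 0.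
Proof.
move=> abc0.
have J_unit : diag3 a b c \in unitmx.
  rewrite unitmxE unitfE det_diag; apply/prodf_neq0 => j _.
  by rewrite mxE abc0.
by rewrite -[in RHS](mulKVmx J_unit v) diag3_mulmxE mulKf.
Qed.

Lemma dotmulE (R : realType) (u v : 'cV[R]_3) :
  dotmul u v = \sum_i u i 0 * v i 0.
Proof. by rewrite /dotmul mxE; apply: eq_bigr => i _; rewrite mxE. Qed.

Lemma norm2_sqr (R : realType) (u : 'cV[R]_3) :
  norm2 u ^+ 2 = \sum_i u i 0 ^+ 2.
Proof.
have uE : dotmul u u = \sum_i u i 0 ^+ 2 by rewrite dotmulE.
by rewrite sqr_sqrtr uE// sumr_ge0// => i _; rewrite sqr_ge0.
Qed.

Theorem theorem14 (R : realType) (k I A1 A2 A3 : R)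
    (hk : 0 < k) (hI : 0 < I)
    (hA1 : 0 < A1) (hA12 : A1 <= A2) (hA23 : A2 <= A3)
    (Om Om1 : R -> 'cV[R]_3) :
  let J := diag3 A1 A2 A3 in
  let p := fun t : R => Om t 0 0 in
  let q := fun t : R => Om t 1 0 in
  let r := fun t : R => Om t 2 0 in
  is_solution k I J Om Om1 ->
  [/\ (A1 = A2 -> A2 < A3 ->
       (A3 - I) * (A3 - A1) * r 0 ^+ 2
         + 2 * dotmul (J *m Om 0) (I *: Om1 0)
         > A1 * I * (norm2 (Om 0) ^+ 2 + norm2 (Om1 0) ^+ 2) ->
       p t @[t --> +oo] --> (0 : R) /\ q t @[t --> +oo] --> (0 : R)),
      (A1 < A2 -> A2 < A3 ->
       (A2 - I) * (A2 - A1) * q 0 ^+ 2 + (A3 - I) * (A3 - A1) * r 0 ^+ 2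
         + 2 * dotmul (J *m Om 0) (I *: Om1 0)
         > A1 * I * (norm2 (Om 0) ^+ 2 + norm2 (Om1 0) ^+ 2) ->
       (A1 - I) * (A1 - A2) * p 0 ^+ 2 + (A3 - I) * (A3 - A2) * r 0 ^+ 2
         + 2 * dotmul (J *m Om 0) (I *: Om1 0)
         > A2 * I * (norm2 (Om 0) ^+ 2 + norm2 (Om1 0) ^+ 2) ->
       p t @[t --> +oo] --> (0 : R) /\ q t @[t --> +oo] --> (0 : R))
    & (A1 < A2 -> A2 = A3 ->
       (A3 - I) * (A3 - A1) * (q 0 ^+ 2 + r 0 ^+ 2)
         + 2 * dotmul (J *m Om 0) (I *: Om1 0)
         > A1 * I * (norm2 (Om 0) ^+ 2 + norm2 (Om1 0) ^+ 2) ->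
       p t @[t --> +oo] --> (0 : R))].
Proof.
move=> J p q r sol.
pose a (i : 'I_3) := [:: A1; A2; A3]`_i.
pose w (i : 'I_3) t := Om t i 0.
pose w1 (i : 'I_3) t := Om1 t i 0.
have a_gt0 i : 0 < a i.
  elim/ord3_cases: i => //; first exact: lt_le_trans hA12.
  by apply: lt_le_trans hA23; exact: lt_le_trans hA12.
have dw i : deriv_nonneg (w i) (fun t => (a i)^-1 * (k * (w1 i t - w i t)
    - (a (i + 2) - a (i + 1)) * (w (i + 1) t * w (i + 2) t))).
  apply: slope_deriv_nonneg => t t0; have [dOm _] := sol t t0.
  have JE j : (J *m Om t) j 0 = a j * w j t by exact: diag3_mulmxE.
  move: (J *m Om t) JE dOm => u uE dOm.
  rewrite [X in _ --> X](_ : _ = (invmx J *m (k *: (Om1 t - Om t)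
      - crossmul (Om t) u)) i 0); first exact: is_derive_nonneg_coord.
  rewrite invmx_diag3_mulmxE; last by move=> j; rewrite gt_eqF//; exact: a_gt0.
  by rewrite !mxE !uE -/(a i) /w /w1; congr (_ * _); ring.
have dw1 i : deriv_nonneg (w1 i) (fun t => - (k / I) * (w1 i t - w i t)
    - (w (i + 1) t * w1 (i + 2) t - w (i + 2) t * w1 (i + 1) t)).
  apply: slope_deriv_nonneg => t t0; have [_ dOm1] := sol t t0.
  rewrite [X in _ --> X](_ : _ = (- (k / I) *: (Om1 t - Om t)
      - crossmul (Om t) (Om1 t)) i 0); first exact: is_derive_nonneg_coord.
  by rewrite !mxE.
have main b i : 0 < b -> a i <= b -> 0 < excess I a w w1 b 0 ->
    w i t @[t --> +oo] --> 0.
  by move=> b0; exact: (component_decay hk hI a_gt0 dw dw1 (ltW b0)).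
rewrite !dotmulE !norm2_sqr !sum3E !diag3_mulmxE !mxE.
(* The assumed inequalities are rearrangements of a positive excess. *)
have excess_gt0 b x y : y < x -> excess I a w w1 b 0 = x - y ->
    0 < excess I a w w1 b 0.
  by move=> yx ->; rewrite subr_gt0.
rewrite /p /q /r; split.
- move=> A12 A23 /(@excess_gt0 A1) K.
  have {}K : 0 < excess I a w w1 A1 0.
    apply: K; rewrite /excess /energy /momentum !sum3E /a /= -A12 /w /w1; ring.
  by split; apply: (main A1) K => //; rewrite /a /= -A12.
- move=> A12 A23 _ /(@excess_gt0 A2) K.
  have {}K : 0 < excess I a w w1 A2 0.
    apply: K; rewrite /excess /energy /momentum !sum3E /a /= /w /w1; ring.
  by split; apply: (main A2) K => //; exact: (a_gt0 1).
- move=> A12 A23 /(@excess_gt0 A1) K.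
  apply: (main A1) => //; apply: K.
  rewrite /excess /energy /momentum !sum3E /a /= A23 /w /w1; ring.
Qed.
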